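(* Let $\mathscr{A}$ be a (not necessarily unital) complex $^*$-algebra, and let $f,g$ be representable functionals on $\mathscr{A}$. Then the functional $f_r=(f:g)\div g$ is representable and $g$-absolutely continuous. Furthermore, the decomposition $$f=f_r+(f-f_r)$$ is a Lebesgue-type decomposition of $f$ with respect to $g$ (that is, $f_r\ll g$ and $f-f_r\perp g$). Here the absolutely continuous part $f_r$ can be written as $$f_r=(g-g:f)_{g}-g,$$ where $(g-g:f)_g$ denotes the complement of $g-(g:f)$ with respect to $g$.
   Context: A linear functional $f$ on a complex $^*$-algebra $\mathscr{A}$ is representable if there are a Hilbert space $H_f$, a $^*$-homomorphism $\pi_f:\mathscr{A}\to\mathscr{B}(H_f)$ and a vector $\xi_f\in H_f$ such that $f(a)=(\pi_f(a)\xi_f\,|\,\xi_f)_f$ for all $a\in\mathscr{A}$. The order between representable functionals is: $h\leq h'$ iff $h(a^*a)\leq h'(a^*a)$ for all $a\in\mathscr{A}$. Complement: let $f$ be a representable functional and $g$ a linear functional with $|g(a)|^2\leq Cf(a^*a)$ for all $a\in\mathscr{A}$ and some constant $C\geq0$. The complement $f_g$ of $f$ with respect to $g$ is the smallest representable functional $h$ satisfying $f(a^*a)+g(b^*a)+\overline{g(b^*a)}+h(b^*b)\geq0$ for all $a,b\in\mathscr{A}$ (under the stated bound it exists). It satisfies $f_g(a^*a)=\sup\{g(a^*b)+\overline{g(a^*b)}-f(b^*b):b\in\mathscr{A}\}$. Parallel sum: for representable $f,g$, the complement $(f+g)_f$ exists and the parallel sum $f:g:=f-(f+g)_f$ is a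 representable functional, satisfying $(f:g)(a^*a)=\inf\{f((a+b)^*(a+b))+g(b^*b):b\in\mathscr{A}\}$. Parallel difference: for representable $f,g$ with $f\geq g$ such that the complement $(f-g)_f$ exists, the parallel difference is $g\div f:=(f-g)_f-f$; it satisfies $(g\div f)(a^*a)=\sup\{g((a+b)^*(a+b))-f(b^*b):b\in\mathscr{A}\}$. (A sufficient condition for existence is $|f(a)|^2\leq C(f(a^*a)-g(a^*a))$ for all $a\in\mathscr{A}$ and some $C\geq0$.) Absolute continuity and singularity: for representable $f,g$, $f$ is $g$-absolutely continuous ($f\ll g$) if for every sequence $(a_n)$ in $\mathscr{A}$ such that $g(a_n^*a_n)\to0$ and $f((a_n-a_m)^*(a_n-a_m))\to0$ ($n,m\to\infty$) it follows that $f(a_n^*a_n)\to0$. $f$ and $g$ are singular ($f\perp g$) if $h=0$ is the only representable functional with $h\leq f$ and $h\leq g$. A decomposition $f=f_1+f_2$ into representable functionals is a Lebesgue-type decomposition of $f$ with respect to $g$ if $f_1\ll g$ and $f_2\perp g$. *)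

(* Defs.v *)
From HB Require Import structures.
From mathcomp Require Import all_boot all_order all_algebra.
From mathcomp Require Import sesquilinear complex.
From mathcomp Require Import boolp classical_sets functions reals topology.
From mathcomp Require Import normedtype sequences.

Set Implicit Arguments.
Unset Strict Implicit.
Unset Printing Implicit Defensive.

Import Order.TTheory GRing.Theory Num.Theory.
Import numFieldNormedType.Exports.

Local Open Scope classical_set_scope.
Local Open Scope ring_scope.

(* Complex Hilbert spaces; the inner product is linear in its first argument
   and conjugate linear in its second one. *)
HB.mixin Record CompleteNormedModule_isHilbert (R : realType) (H : Type)
    & CompleteNormedModule R[i] H := {
  inner : {dot H for @Num.conj R[i]} ;
  inner_norm : forall x : H, inner x x = `|x| ^+ 2
}.

#[short(type="hilbertType")]
HB.structure Definition Hilbert (R : realType) :=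
  { H of CompleteNormedModule R[i] H & CompleteNormedModule_isHilbert R H }.

(* Complex *-algebras. No unit is assumed, so that the algebra structures of
   the library, which all have one, cannot be used. *)
HB.mixin Record Lmodule_isStarAlgebra (R : realType) (A : Type)
    & GRing.Lmodule R[i] A := {
  smul : A -> A -> A ;
  star : A -> A ;
  smulA : associative smul ;
  smulDl : left_distributive smul +%R ;
  smulDr : right_distributive smul +%R ;
  smulZl : forall (k : R[i]) (a b : A), smul (k *: a) b = k *: smul a b ;
  smulZr : forall (k : R[i]) (a b : A), smul a (k *: b) = k *: smul a b ;
  starK : involutive star ;
  starD : {morph star : a b / a + b} ;
  starZ : forall (k : R[i]) (a : A), star (k *: a) = k^* *: star a ;
  starM : forall a b : A, star (smul a b) = smul (star b) (star a)
}.

#[short(type="starAlgType")]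
HB.structure Definition StarAlgebra (R : realType) :=
  { A of GRing.Lmodule R[i] A & Lmodule_isStarAlgebra R A }.

Notation "a ** b" := (smul a b) (at level 40, left associativity) : ring_scope.

Section Functionals.
Context {R : realType} {A : starAlgType R}.
Local Notation C := R[i].

Definition bounded_operator (H : hilbertType R) (T : H -> H) : Prop :=
  linear T /\ exists M : C, forall x, `|T x| <= M * `|x|.

Definition star_representation (H : hilbertType R) (pi : A -> H -> H) : Prop :=
  [/\ forall a, bounded_operator (pi a),
      forall a b x, pi (a + b) x = pi a x + pi b x,
      forall (k : C) a x, pi (k *: a) x = k *: pi a x,
      forall a b x, pi (a ** b) x = pi a (pi b x)
    & forall a x y, inner (pi a x) y = inner x (pi (star a) y)].

Definition representable (f : A -> C) : Prop :=
  scalar f /\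
  exists (H : hilbertType R) (pi : A -> H -> H) (xi : H),
    star_representation pi /\ forall a, f a = inner (pi a xi) xi.

(* In R[i], z <= w means that w - z is a nonnegative real number. *)
Definition le_functional (h h' : A -> C) : Prop :=
  forall a, h (star a ** a) <= h' (star a ** a).

Definition complement_ineq (f g h : A -> C) : Prop :=
  forall a b, 0 <= f (star a ** a) + g (star b ** a)
                   + (g (star b ** a))^* + h (star b ** b).

Definition is_complement (f g h : A -> C) : Prop :=
  [/\ representable h, complement_ineq f g h
    & forall h', representable h' -> complement_ineq f g h' ->
        le_functional h h'].

Definition complement_exists (f g : A -> C) : Prop :=
  exists h, is_complement f g h.

(* f_g, with the junk value 0 when the complement does not exist *)
Definition complement (f g : A -> C) : A -> C :=
  xget (0 : A -> C) [set h | is_complement f g h].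

Definition parallel_sum (f g : A -> C) : A -> C := f - complement (f + g) f.

(* parallel_diff g f is g ÷ f, which is meaningful
   when parallel_diff_defined g f holds. *)
Definition parallel_diff_defined (g f : A -> C) : Prop :=
  [/\ representable g, representable f, le_functional g f
    & complement_exists (f - g) f].

Definition parallel_diff (g f : A -> C) : A -> C := complement (f - g) f - f.

Definition abs_continuous (f g : A -> C) : Prop :=
  forall u : nat -> A,
    (fun n => g (star (u n) ** u n) : C^o) @ \oo --> (0 : C^o) ->
    (fun nm : nat * nat =>
       f (star (u nm.1 - u nm.2) ** (u nm.1 - u nm.2)) : C^o) @ (\oo, \oo)
      --> (0 : C^o) ->
    (fun n => f (star (u n) ** u n) : C^o) @ \oo --> (0 : C^o).

Definition singular (f g : A -> C) : Prop :=
  forall h, representable h -> le_functional h f -> le_functional h g -> h = 0.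

Definition lebesgue_decomposition (f g f1 f2 : A -> C) : Prop :=
  [/\ representable f1, representable f2, f = f1 + f2,
      abs_continuous f1 g & singular f2 g].

End Functionals.

(* Main.v *)
(* Represent f and g jointly on the direct sum of two Hilbert spaces by a vector
   x = (x.1, x.2) lying in K, the closure of its orbit. Complements become
   explicit: if f is given by the vector x on products and g (b^* a) =
   (pi a x | pi b z), then f_g is the vector functional of z. With z and t the
   projections of (x.1, 0) and (0, x.2) onto K, this makes f : g the functional
   a |-> (pi a t | z), and g - f : g the vector functional of t. Let L be the
   closure of the orbit of t and w the projection of x onto L. Then (g - f : g)_g
   is the vector functional of w, and v = x - w has zero second component, so
   that f_r and f - f_r are the vector functionals of w.1 and v.1.

   Absolute continuity: if pi2 (u n) x.2 tends to 0 and pi1 (u n) w.1 tends to y,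
   then (y, 0) lies in L and is orthogonal to L, since for y' in K the product
   (pi a t | y') only depends on y'.2. Singularity: pi a v is a limit of vectors
   pi b x in K, and then pi2 b x.2 and pi (a - b) v both tend to 0, so that any
   functional below both f - f_r and g vanishes. *)
Require Import Defs.
From HB Require Import structures.
From mathcomp Require Import all_boot all_order all_algebra.
From mathcomp Require Import sesquilinear complex.
From mathcomp Require Import boolp classical_sets functions reals topology.
From mathcomp Require Import normedtype.
From mathcomp Require Import interval_inference ring lra.
Set Implicit Arguments.
Unset Strict Implicit.
Unset Printing Implicit Defensive.
Import Order.TTheory GRing.Theory Num.Theory.
Import numFieldNormedType.Exports.
Local Open Scope classical_set_scope.
Local Open Scope ring_scope.
Local Notation re := complex.Re.

(** * Direct sums of Hilbert spaces *)

Lemma re_conj (R : realType) (z : R[i]) : re (z^*) = re z.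
Proof. by case: z. Qed.
Lemma reD (R : realType) (z w : R[i]) : re (z + w) = re z + re w.
Proof. by case: z; case: w. Qed.
Lemma reN (R : realType) (z : R[i]) : re (- z) = - re z.
Proof. by case: z. Qed.

Section DotProduct.
Context {C : numClosedFieldType} {U : lmodType C}
  (form : {dot U for @Num.conj C}).
Local Notation "''[' u , v ]" := (form u%R v%R) : ring_scope.
Local Notation "''[' u ]" := '[u, u]%R : ring_scope.

Lemma dot_conj u v : '[v, u] = ('[u, v])^*.
Proof. by rewrite (hermitian_subproof v u) expr0 mul1r. Qed.

Lemma dot_CauchySchwarz u v : `|'[u, v]| ^+ 2 <= '[u] * '[v].
Proof.
have [->|v0] := eqVneq v 0; first by rewrite !linear0r normr0 expr0n mulr0.
pose a := '[u, v] / '[v]; pose w := u - a *: v.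
have wv : '[w, v] = 0.
  by rewrite /w linearBl linearZl_LR/= divfK ?subrr// dnorm_eq0.
have -> : u = w + a *: v by rewrite subrK.
rewrite [X in `|X|]linearDl /= wv add0r linearZl_LR/= normrM.
rewrite (ger0_norm (dnorm_ge0 _ _)) hnormDd/=;
  last by rewrite linearZr_LR/= wv mulr0.
rewrite dnormZ exprMn [in leLHS]expr2 mulrDl !mulrA lerDr.
by rewrite mulr_ge0// dnorm_ge0.
Qed.

Lemma dot_triangle u v : sqrtC '[u + v] <= sqrtC '[u] + sqrtC '[v].
Proof.
rewrite -ler_sqr ?nnegrE ?addr_ge0 ?sqrt_dnorm_ge0// sqrrD !sqrtCK dnormD.
rewrite [leRHS]addrAC lerD2l.
have rr : '[u, v] + ('[u, v])^* \is Num.real.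
  by apply/CrealP; rewrite rmorphD /= conjCK addrC.
apply: le_trans (real_ler_norm rr) _.
apply: le_trans (ler_normD _ _) _.
rewrite norm_conjC -mulr2n ler_pMn2r//.
rewrite -ler_sqr ?nnegrE ?mulr_ge0 ?sqrt_dnorm_ge0//.
by rewrite exprMn !sqrtCK dot_CauchySchwarz.
Qed.
End DotProduct.

Section DirectSum.
Context {R : realType} (H1 H2 : hilbertType R).

(** Only the module structure of the product is copied: its supremum norm does not come from an
    inner product. *)
Definition hsum : Type := (H1 * H2)%type.
HB.instance Definition _ := GRing.Lmodule.copy hsum (H1 * H2)%type.

Definition hsum_inner (x y : hsum) : R[i] := inner x.1 y.1 + inner x.2 y.2.

Lemma hsum_inner_linearl y : scalar (hsum_inner^~ y).
Proof.
move=> k u v; rewrite /hsum_inner /= !linearDl !linearZl_LR /= mulrDr.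
by rewrite addrACA.
Qed.

Lemma hsum_inner_linearr x : linear_for (@Num.conj R[i] \; *%R) (hsum_inner x).
Proof.
move=> k u v; rewrite /hsum_inner /= !linearDr !linearZr_LR /= mulrDr.
by rewrite addrACA.
Qed.

HB.instance Definition _ := bilinear_isBilinear.Build R[i] hsum hsum R[i]
  *%R (@Num.conj R[i] \; *%R) hsum_inner
  (hsum_inner_linearl, hsum_inner_linearr).

Lemma hsum_inner_herm x y :
  hsum_inner x y = (-1) ^+ false * (hsum_inner y x)^*.
Proof.
by rewrite expr0 mul1r /hsum_inner rmorphD/= -!dot_conj.
Qed.

HB.instance Definition _ :=
  isHermitianSesquilinear.Build _ _ _ _ hsum_inner hsum_inner_herm.

Lemma hsum_inner_gt0 x : x != 0 -> 0 < hsum_inner x x.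
Proof.
move=> x0; rewrite lt_def /hsum_inner addr_ge0 ?dnorm_ge0// andbT.
rewrite paddr_eq0 ?dnorm_ge0// !dnorm_eq0.
by case: x x0 => x1 x2; rewrite -xpair_eqE.
Qed.

HB.instance Definition _ := isDotProduct.Build _ _ hsum_inner hsum_inner_gt0.

Definition hsum_norm (x : hsum) : R[i] := sqrtC (hsum_inner x x).

Lemma hsum_norm_triangle x y : hsum_norm (x + y) <= hsum_norm x + hsum_norm y.
Proof. exact: dot_triangle. Qed.

Lemma hsum_normZ (k : R[i]) x : hsum_norm (k *: x) = `|k| * hsum_norm x.
Proof.
by rewrite /hsum_norm dnormZ sqrtCM ?nnegrE ?exprn_ge0 ?dnorm_ge0// sqrCK.
Qed.

Lemma hsum_norm_eq0 x : hsum_norm x = 0 -> x = 0.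
Proof. by move=> /eqP; rewrite sqrtC_eq0 dnorm_eq0 => /eqP. Qed.

HB.instance Definition _ := Lmodule_isNormed.Build R[i] hsum
  hsum_norm_triangle hsum_normZ hsum_norm_eq0.

Lemma hsum_innerE (x : hsum) : hsum_inner x x = `|x| ^+ 2.
Proof. by rewrite sqrtCK. Qed.

Lemma hsum_normE (x : hsum) : `|x| ^+ 2 = `|x.1| ^+ 2 + `|x.2| ^+ 2.
Proof. by rewrite -hsum_innerE /hsum_inner !inner_norm. Qed.

Lemma norm_fst_le (x : hsum) : `|x.1| <= `|x|.
Proof. by rewrite -ler_sqr ?nnegrE// hsum_normE lerDl exprn_ge0. Qed.

Lemma norm_snd_le (x : hsum) : `|x.2| <= `|x|.
Proof. by rewrite -ler_sqr ?nnegrE// hsum_normE lerDr exprn_ge0. Qed.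

Lemma hsum_norm_le (x : hsum) : `|x| <= `|x.1| + `|x.2|.
Proof.
rewrite -ler_sqr ?nnegrE ?addr_ge0// hsum_normE sqrrD addrAC lerDl.
by rewrite mulrn_wge0// mulr_ge0.
Qed.

Lemma hsum_complete (F : set_system hsum) :
  ProperFilter F -> cauchy F -> cvg F.
Proof.
move=> FF /cauchyP cF.
have /cauchy_cvg/cvg_ex[l1 l1P] : cauchy ((@fst H1 H2 : hsum -> H1) @ F).
  apply: cauchy_exP => e e0; have [x Fx] := cF e e0.
  exists x.1; apply: (filterS _ Fx : F [set y : hsum | ball x.1 e y.1]) => y.
  rewrite -!ball_normE /=; apply: le_lt_trans; exact: (norm_fst_le (x - y)).
have /cauchy_cvg/cvg_ex[l2 l2P] : cauchy ((@snd H1 H2 : hsum -> H2) @ F).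
  apply: cauchy_exP => e e0; have [x Fx] := cF e e0.
  exists x.2; apply: (filterS _ Fx : F [set y : hsum | ball x.2 e y.2]) => y.
  rewrite -!ball_normE /=; apply: le_lt_trans; exact: (norm_snd_le (x - y)).
apply/cvg_ex; exists ((l1, l2) : hsum); apply/fcvgrPdist_lt => e e0.
have e2 : 0 < e / 2 by rewrite divr_gt0.
move/cvgrPdist_lt : l1P => /(_ _ e2) l1P.
move/cvgrPdist_lt : l2P => /(_ _ e2) l2P.
apply: filterS2 l1P l2P => y y1 y2.
apply: le_lt_trans (hsum_norm_le _) _.
by rewrite [ltRHS]splitr ltrD.
Qed.

HB.instance Definition _ := Uniform_isComplete.Build hsum hsum_complete.
HB.instance Definition _ :=
  CompleteNormedModule_isHilbert.Build R hsum hsum_innerE.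

End DirectSum.

(** * Inner products and real-valued squared norms *)

Section InnerProduct.
Context {R : realType} {H : hilbertType R}.
Implicit Types (x y z : H) (k : R[i]).

Lemma innerDl x y z : inner (x + y) z = inner x z + inner y z.
Proof. exact: linearDl. Qed.
Lemma innerBl x y z : inner (x - y) z = inner x z - inner y z.
Proof. exact: linearBl. Qed.
Lemma innerDr x y z : inner x (y + z) = inner x y + inner x z.
Proof. exact: linearDr. Qed.
Lemma innerBr x y z : inner x (y - z) = inner x y - inner x z.
Proof. exact: linearBr. Qed.
Lemma innerZl k x y : inner (k *: x) y = k * inner x y.
Proof. exact: linearZl_LR. Qed.
Lemma innerZr k x y : inner x (k *: y) = k^* * inner x y.
Proof. exact: linearZr_LR. Qed.
Lemma innerNl x y : inner (- x) y = - inner x y.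
Proof. exact: linearNl. Qed.
Lemma inner0l x : inner 0 x = 0. Proof. exact: linear0l. Qed.
Lemma inner0r x : inner x 0 = 0. Proof. exact: linear0r. Qed.
Lemma innerC x y : inner y x = (inner x y)^*.
Proof. exact: dot_conj. Qed.

(** Taken in the totally ordered field [R], so that estimates become polynomial inequalities over
    the reals. *)
Definition nsq x : R := re (inner x x).

Lemma nsqE x : inner x x = (nsq x)%:C%C.
Proof. by rewrite RRe_real// ger0_real// dnorm_ge0. Qed.

Lemma nsq_ge0 x : 0 <= nsq x.
Proof. by rewrite -ler0c -nsqE dnorm_ge0. Qed.

Lemma nsq_eq0 x : nsq x = 0 -> x = 0.
Proof. by move=> h; apply/eqP; rewrite -(dnorm_eq0 inner) /= nsqE h. Qed.

Lemma nsq0 : nsq 0 = 0 :> R.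
Proof. by rewrite /nsq inner0l. Qed.

Lemma nsqD x y : nsq (x + y) = nsq x + nsq y + 2 * re (inner x y).
Proof.
by rewrite /nsq innerDl !innerDr !reD [inner y x]innerC re_conj; ring.
Qed.

Lemma nsqN x : nsq (- x) = nsq x.
Proof.
by rewrite -scaleN1r /nsq innerZl innerZr rmorphN1 mulN1r mulN1r opprK.
Qed.

Lemma nsqBC x y : nsq (x - y) = nsq (y - x).
Proof. by rewrite -nsqN opprB. Qed.

Lemma nsqB x y : nsq (x - y) = nsq x + nsq y - 2 * re (inner x y).
Proof.
by rewrite /nsq innerBl !innerBr !(reD, reN) [inner y x]innerC re_conj; ring.
Qed.

Lemma nsqD_le x y : nsq (x + y) <= 2 * nsq x + 2 * nsq y.
Proof. have := nsq_ge0 (x - y); rewrite nsqB nsqD; lra. Qed.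

Lemma inner_CS x y : `|inner x y| ^+ 2 <= (nsq x * nsq y)%:C%C.
Proof. by rewrite rmorphM /= -!nsqE; exact: dot_CauchySchwarz. Qed.

Lemma re_inner_CS x y : re (inner x y) ^+ 2 <= nsq x * nsq y.
Proof.
by have := inner_CS x y; rewrite -add_Re2_Im2 lecR; apply: le_trans;
  rewrite lerDl sqr_ge0.
Qed.

Lemma nsq_norm x : (nsq x)%:C%C = `|x| ^+ 2.
Proof. by rewrite -nsqE inner_norm. Qed.

(** By Cauchy-Schwarz [inner x] is continuous, so orthogonality to [x] passes to limits. *)
Lemma inner_approx_eq0 x y :
  (forall e : R, 0 < e -> exists2 z, inner x z = 0 & nsq (y - z) < e) ->
  inner x y = 0.
Proof.
move=> h; suff : (`|inner x y| ^+ 2 <= 0).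
  by rewrite -normrX normr_le0 expf_eq0 /= => /eqP.
rewrite -add_Re2_Im2 (_ : 0 = (0:R)%:C%C) // lecR.
apply/ler_addgt0Pr => e e0; rewrite add0r.
have n0 := nsq_ge0 x.
(* Adding 1 keeps the denominator positive when [x] is zero. *)
have [z xz yz] := h (e / (nsq x + 1)) (divr_gt0 e0 (ltr_wpDl n0 ltr01)).
have : (`|inner x y| ^+ 2 <= (nsq x * nsq (y - z))%:C%C).
  by rewrite -[inner x y]subr0 -xz -innerBr inner_CS.
rewrite -add_Re2_Im2 lecR => /le_trans; apply.
move: yz; rewrite ltr_pdivlMr ?ltr_wpDl// => /ltW; apply: le_trans.
by rewrite mulrDr mulr1 mulrC lerDl nsq_ge0.
Qed.
End InnerProduct.

(** * Orthogonal projections *)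

Section HilbertSpace.
Context {R : realType} {H : hilbertType R}.
Implicit Types (x y z : H) (k : R[i]) (K : set H).

Lemma norm_lt_nsq x (e : R) : 0 < e -> (`|x| < e%:C%C) = (nsq x < e ^+ 2).
Proof.
move=> e0; rewrite -ltr_sqr ?nnegrE ?ler0c ?(ltW e0)//.
by rewrite -[X in X < _](nsq_norm x) -rmorphXn ltcR.
Qed.

Lemma gt0_complexP (e : R[i]) : 0 < e -> exists2 r : R, 0 < r & e = r%:C%C.
Proof.
by case: e => a b; rewrite ltcE /= => /andP[/eqP -> a0]; exists a.
Qed.

Lemma re_innerZr (t : R) x y : re (inner x (t%:C%C *: y)) = t * re (inner x y).
Proof.
by rewrite innerZr; case: (inner x y) => a b /=; rewrite oppr0 mul0r subr0.
Qed.

Lemma nsqZ (t : R) x : nsq (t%:C%C *: x) = t ^+ 2 * nsq x.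
Proof.
rewrite /nsq innerZl innerZr; case: (inner x x) => a b /=.
by rewrite oppr0 !mul0r !subr0 expr2 mulrA.
Qed.

Lemma nsq_cauchy_cvg (u : nat -> H) :
  (forall e : R, 0 < e -> exists N, forall n m, (N <= n)%N -> (N <= m)%N ->
    nsq (u n - u m) < e) ->
  exists l, forall e : R, 0 < e -> exists N, forall n, (N <= n)%N ->
    nsq (l - u n) < e.
Proof.
move=> cu; have /cauchy_cvg/cvg_ex[l ul] : cauchy (u @ \oo).
  apply: cauchy_exP => _ /gt0_complexP[r r0 ->].
  have [N uN] := cu _ (exprn_gt0 2 r0).
  exists (u N), N => // n /= Nn.
  by rewrite -ball_normE /= norm_lt_nsq// uN.
exists l => e e0; move/cvgrPdist_lt : ul => /(_ (Num.sqrt e)%:C%C).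
rewrite ltcR sqrtr_gt0 => /(_ e0)[N _ uN]; exists N => n Nn.
by have := uN n Nn; rewrite /= norm_lt_nsq ?sqrtr_gt0// sqr_sqrtr// ltW.
Qed.

Definition closed_subspace K := [/\ K 0,
  forall k x y, K x -> K y -> K (k *: x + y) &
  forall x, (forall e : R, 0 < e -> exists2 y, K y & nsq (x - y) < e) -> K x].

Lemma closed_subspaceD K x y : closed_subspace K -> K x -> K y -> K (x + y).
Proof. by case=> _ hK _ Kx Ky; rewrite -(scale1r x); apply: hK. Qed.

Lemma closed_subspaceZ K k x : closed_subspace K -> K x -> K (k *: x).
Proof. by case=> K0 hK _ Kx; rewrite -[_ *: _]addr0; apply: hK. Qed.

Lemma closed_subspaceB K x y : closed_subspace K -> K x -> K y -> K (x - y).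
Proof.
move=> hK Kx Ky; rewrite -scaleN1r.
by apply: closed_subspaceD => //; exact: closed_subspaceZ.
Qed.

Lemma quadratic_ge0 (a b c : R) : 0 <= c ->
  (forall t : R, 0 <= a - 2 * t * b + t ^+ 2 * c) -> b ^+ 2 <= a * c.
Proof.
rewrite le_eqVlt => /predU1P[<-|c0] h.
  have [->|b0] := eqVneq b 0; first by rewrite expr0n mulr0.
  (* With [c = 0] and [b] nonzero, the affine function of [t] takes the value -1 here. *)
  have := h ((a + 1) / (2 * b)).
  have -> : a - 2 * ((a + 1) / (2 * b)) * b + ((a + 1) / (2 * b)) ^+ 2 * 0 = - 1
    by field.
  by rewrite lerNr oppr0 ler10.
(* The quadratic attains its minimum at [b / c]. *)
have := h (b / c).
have -> : a - 2 * (b / c) * b + (b / c) ^+ 2 * c = (a * c - b ^+ 2) / c.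
  by field; rewrite gt_eqF.
by rewrite pmulr_lge0 ?invr_gt0// subr_ge0.
Qed.

(* The minimising sequence is Cauchy by the parallelogram law. *)
Theorem orthogonal_projection K x : closed_subspace K ->
  exists2 p, K p & forall y, K y -> inner (x - p) y = 0.
Proof.
move=> hK; have [K0 _ Kcl] := hK.
pose D := [set nsq (x - y) | y in K].
have D0 : D !=set0 by exists (nsq (x - 0)), 0.
have Dlb : has_lbound D by exists 0 => _ [y _ <-]; exact: nsq_ge0.
pose d := inf D.
have dle y : K y -> d <= nsq (x - y).
  by move=> Ky; apply: ge_inf => //; exists y.
have [u uK] : {u : nat -> H & forall n,
    K (u n) /\ nsq (x - u n) < d + n.+1%:R^-1}.
  apply: (@choice _ _ (fun n y => K y /\ nsq (x - y) < d + n.+1%:R^-1)) => n.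
  have n0 : (0 : R) < n.+1%:R^-1 by rewrite invr_gt0 ltr0n.
  have [_ [y Ky <-] yd] := inf_adherent n0 (conj D0 Dlb).
  by exists y.
have small (e : R) : 0 < e -> exists N, forall n, (N <= n)%N -> n.+1%:R^-1 < e.
  by move=> e0; have [N _ h] := near_infty_natSinv_lt (PosNum e0); exists N.
have [|p up] := @nsq_cauchy_cvg u.
  (* The midpoint of [u n] and [u m] lies in [K], at squared distance at least [d] from [x]. The
     parallelogram law then leaves twice the two excesses over [d], each below [e / 4]. *)
  move=> e e0; have [N uN] := small _ (divr_gt0 e0 (ltr0n R 4)).
  exists N => n m Nn Nm.
  have [Kn un] := uK n; have [Km um] := uK m.
  have := dle ((2^-1 : R)%:C%C *: (u n + u m)).
  have -> : nsq (u n - u m) = 2 * nsq (x - u n) + 2 * nsq (x - u m)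
      - 4 * nsq (x - (2^-1 : R)%:C%C *: (u n + u m)).
    have half z : (2^-1 : R)%:C%C *: (z + z) = z.
      rewrite scalerDr -scalerDl -rmorphD /=.
      have -> : 2^-1 + 2^-1 = 1 :> R by field.
      by rewrite rmorph1 scale1r.

    have -> : u n - u m = (x - u m) - (x - u n).
      by rewrite opprB [RHS]addrC addrA subrK.
    have -> : x - (2^-1 : R)%:C%C *: (u n + u m) =
        (2^-1 : R)%:C%C *: ((x - u m) + (x - u n)).
      by rewrite addrACA -opprD scalerBr half [u m + u n]addrC.
    rewrite nsqZ; move: (x - u m) (x - u n) => v w.
    by rewrite nsqB nsqD; field.
  move/(_ (closed_subspaceZ _ hK (closed_subspaceD hK Kn Km))).
  have := uN _ Nn; have := uN _ Nm; rewrite !ltr_pdivlMr//; move: un um.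
  by move: (n.+1%:R^-1) (m.+1%:R^-1) => a b; lra.
have Kp : K p.
  by apply: Kcl => e /up[N uN]; exists (u N); [case: (uK N)|apply: uN].
exists p => // y Ky.
have re0 z : K z -> re (inner (x - p) z) = 0.
  move=> Kz; apply/eqP; rewrite -sqrf_eq0 eq_le sqr_ge0 andbT.
  apply/ler_addgt0Pr => e e0; rewrite add0r.
  have z0 := nsq_ge0 z.
  (* The square of a sum of two terms is at most twice the sum of their squares; each square will be
     below [e / 4]. *)
  have z1 : 0 < 4 * (nsq z + 1) by rewrite mulr_gt0// ltr_wpDl.
  have e1 : 0 < e / (4 * (nsq z + 1)) by rewrite divr_gt0.
  have [N1 h1] := small _ e1; have [N2 h2] := up _ e1.
  pose n := maxn N1 N2.
  have {}h1 := h1 n (leq_maxl _ _); have {}h2 := h2 n (leq_maxr _ _).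
  have [Kn un] := uK n.
  (* Moving from [u n] along [z] stays in [K], so the squared distance to [x] cannot drop below [d],
     and it starts within [n.+1%:R^-1] of [d]. The discriminant of this quadratic in [t] gives the
     bound. *)
  have b1 : re (inner (x - u n) z) ^+ 2 <= n.+1%:R^-1 * nsq z.
    apply: quadratic_ge0 => // t.
    have := dle (u n + t%:C%C *: z)
      (closed_subspaceD hK Kn (closed_subspaceZ _ hK Kz)).
    rewrite opprD addrA nsqB.
    have -> : nsq (t%:C%C *: z) = t ^+ 2 * nsq z.
      exact: nsqZ.
    rewrite re_innerZr; move: un; move: (n.+1%:R^-1) => a; lra.
  have b2 := re_inner_CS (u n - p) z.
  have -> : x - p = (x - u n) + (u n - p) by rewrite addrA subrK.
  rewrite innerDl reD.
  rewrite nsqBC in b2.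
  have := sqr_ge0 (re (inner (x - u n) z) - re (inner (u n - p) z)).
  have a0 : (0 : R) <= n.+1%:R^-1 by rewrite invr_ge0 ler0n.
  have q0 := nsq_ge0 (p - u n).
  move: h1 h2 b1 b2 a0 q0; rewrite !ltr_pdivlMr//.
  move: (n.+1%:R^-1) (nsq (p - u n)) => a q h1 h2 b1 b2 a0 q0; lra.
(* The real part of the product with [i y] yields the imaginary part. *)
have := re0 _ Ky.
have := re0 _ (closed_subspaceZ (Complex 0 1) hK Ky).
rewrite innerZr; case: (inner (x - p) y) => a b /= h1 h2.
by apply/eqP; rewrite eq_complex /=; apply/andP; split; apply/eqP; lra.
Qed.
End HilbertSpace.

(** * Representations and cyclic subspaces *)

Lemma norm_le_nsq {R : realType} {H : hilbertType R} (x y : H) (M : R) :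
  0 <= M -> nsq x <= M * nsq y -> `|x| <= (Num.sqrt M)%:C%C * `|y|.
Proof.
move=> M0 h; rewrite -ler_sqr ?nnegrE ?mulr_ge0 ?ler0c ?sqrtr_ge0//.
by rewrite exprMn -rmorphXn /= sqr_sqrtr// -!nsq_norm -rmorphM lecR.
Qed.

Section Representation.
Context {R : realType} {A : starAlgType R} {H : hilbertType R}.
Variable pi : A -> H -> H.
Hypothesis hpi : star_representation pi.
Implicit Types (a b c : A) (x y z : H).

Lemma rep_linear a : linear (pi a).
Proof. by case: hpi => /(_ a)[]. Qed.

Lemma repD a x y : pi a (x + y) = pi a x + pi a y.
Proof. by rewrite -[x]scale1r rep_linear !scale1r. Qed.

Lemma rep0 a : pi a 0 = 0.
Proof. by apply: (addrI (pi a 0)); rewrite -repD !addr0. Qed.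

Lemma repN a x : pi a (- x) = - pi a x.
Proof. by apply: (addrI (pi a x)); rewrite -repD !subrr rep0. Qed.

Lemma repB a x y : pi a (x - y) = pi a x - pi a y.
Proof. by rewrite repD repN. Qed.

Lemma rep_addl a b x : pi (a + b) x = pi a x + pi b x.
Proof. by case: hpi. Qed.

Lemma rep_scalel k a x : pi (k *: a) x = k *: pi a x.
Proof. by case: hpi. Qed.

Lemma rep_0l x : pi 0 x = 0.
Proof. by rewrite -(scale0r 0) rep_scalel scale0r. Qed.

Lemma rep_subl a b x : pi (a - b) x = pi a x - pi b x.
Proof. by rewrite rep_addl -[in LHS]scaleN1r rep_scalel scaleN1r. Qed.

Lemma rep_mul a b x : pi (a ** b) x = pi a (pi b x).
Proof. by case: hpi. Qed.

Lemma rep_adj a x y : inner (pi a x) y = inner x (pi (star a) y).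
Proof. by case: hpi. Qed.

Lemma rep_star_mul a b x y :
  inner (pi (star b ** a) x) y = inner (pi a x) (pi b y).
Proof. by rewrite rep_mul rep_adj starK. Qed.

(** The bound in [bounded_operator] is a complex number, arbitrary if [H] is zero, hence the passage
    to its norm. Adding 1 to the square makes the new constant positive, so that one can divide by
    it. *)
Lemma rep_bounded a :
  exists2 M : R, 0 < M & forall x, nsq (pi a x) <= M * nsq x.
Proof.
have [/(_ a)[_ [M hM]] _ _ _ _] := hpi.
have M0 : 0 <= re `|M| by rewrite -ler0c RRe_real ?normr_real.
exists (re `|M| ^+ 2 + 1) => [|x]; first by rewrite ltr_wpDl// sqr_ge0.
have {}hM : `|pi a x| <= (re `|M|)%:C%C * `|x|.
  rewrite RRe_real ?normr_real// -[`|x|]normr_id -normrM.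
  by apply: le_trans (hM x) (real_ler_norm _); apply/ger0_real/le_trans/hM.
have : (nsq (pi a x))%:C%C <= (re `|M| ^+ 2 * nsq x)%:C%C.
  rewrite rmorphM rmorphXn /= !nsq_norm -exprMn.
  by rewrite ler_sqr ?nnegrE// mulr_ge0// ler0c.
by rewrite lecR => /le_trans; apply; rewrite mulrDl mul1r lerDl nsq_ge0.
Qed.

(** The closure of the orbit of [x]. Without a unit in the algebra, [x] itself may lie outside
    it. *)
Definition cyclic x : set H :=
  [set y | forall e : R, 0 < e -> exists a, nsq (y - pi a x) < e].

Lemma cyclic_orbit x a : cyclic x (pi a x).
Proof. by move=> e e0; exists a; rewrite subrr nsq0. Qed.

Lemma nsq_scale (k : R[i]) x :
  nsq (k *: x) = (re k ^+ 2 + complex.Im k ^+ 2) * nsq x.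
Proof.
apply: (@complexI R); rewrite rmorphM /= add_Re2_Im2 -!nsqE.
exact: dnormZ.
Qed.

Lemma cyclic_closed_subspace x : closed_subspace (cyclic x).
Proof.
split=> [e e0|k y z hy hz e e0|y hy e e0].
- by exists 0; rewrite rep_0l subrr nsq0.
- have e4 : 0 < e / 4 by rewrite divr_gt0.
  pose q := re k ^+ 2 + complex.Im k ^+ 2.
  have q0 : 0 <= q by rewrite addr_ge0 ?sqr_ge0.
  have q1 : 0 < 4 * (q + 1) by rewrite mulr_gt0// ltr_wpDl.
  have [a] := hy _ (divr_gt0 e0 q1); have [b hb] := hz _ e4.
  rewrite ltr_pdivlMr// => ha.
  exists (k *: a + b); rewrite rep_addl rep_scalel opprD addrACA -scalerBr.
  apply: le_lt_trans (nsqD_le _ _) _; rewrite nsq_scale -/q.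
  move: ha hb (nsq_ge0 (y - pi a x)) => ha hb n0.
  nra.
- have e4 : 0 < e / 4 by rewrite divr_gt0.
  have [z hz yz] := hy _ e4; have [a za] := hz _ e4.
  exists a; rewrite -(subrK z y) -addrA.
  by apply: le_lt_trans (nsqD_le _ _) _; lra.
Qed.

Lemma cyclic_rep x y a : cyclic x y -> cyclic x (pi a y).
Proof.
move=> hy e e0; have [M M0 hM] := rep_bounded a.
have [b hb] := hy _ (divr_gt0 e0 M0).
exists (a ** b); rewrite rep_mul -repB; apply: le_lt_trans (hM _) _.
by rewrite mulrC -ltr_pdivlMr.
Qed.

Lemma cyclic_min (K : set H) x : closed_subspace K ->
  (forall a, K (pi a x)) -> cyclic x `<=` K.
Proof.
move=> [_ _ Kcl] Kx y hy; apply: Kcl => e /hy[a ya].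
by exists (pi a x).
Qed.

Lemma cyclic_orth x y z :
  (forall a, inner y (pi a x) = 0) -> cyclic x z -> inner y z = 0.
Proof.
move=> yx hz; apply: inner_approx_eq0 => e /hz[a za].
by exists (pi a x).
Qed.

(** The adjoint of [pi a] is [pi (star a)], which also preserves [K]. *)
Lemma orth_rep (K : set H) y a : (forall b z, K z -> K (pi b z)) ->
  (forall z, K z -> inner y z = 0) -> forall z, K z -> inner (pi a y) z = 0.
Proof. by move=> Kpi yK z Kz; rewrite rep_adj; apply/yK/Kpi. Qed.

(** The vector [pi a (x - p)] is orthogonal to the cyclic subspace, by invariance, and also lies in
    it, as a difference of [pi a x] and [pi a p]. Hence it is zero. *)
Lemma cyclic_projection x : exists2 p, cyclic x p &
  (forall y, cyclic x y -> inner (x - p) y = 0) /\ forall a, pi a p = pi a x.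
Proof.
have [p hp orth] := orthogonal_projection x (cyclic_closed_subspace x).
exists p => //; split=> // a; apply/esym/eqP; rewrite -subr_eq0 -repB.
rewrite -(dnorm_eq0 inner) /=; apply/eqP.
apply: (@orth_rep (cyclic x)) => //; first by move=> b z hz; apply: cyclic_rep.
rewrite repB; apply: (@closed_subspaceB _ _ (cyclic x));
  first exact: cyclic_closed_subspace.
- exact: cyclic_orbit.
- by apply: cyclic_rep.
Qed.

Lemma vector_representable x : representable (fun a => inner (pi a x) x).
Proof.
split=> [k a b|]; last by exists H, pi, x.
by rewrite rep_addl rep_scalel innerDl innerZl.
Qed.
End Representation.

Section DirectSumRep.
Context {R : realType} {A : starAlgType R} {H1 H2 : hilbertType R}.
Variables (pi1 : A -> H1 -> H1) (pi2 : A -> H2 -> H2).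

Definition rep_sum (a : A) (x : hsum H1 H2) : hsum H1 H2 :=
  (pi1 a x.1, pi2 a x.2).

Lemma inner_hsum (x y : hsum H1 H2) :
  inner x y = inner x.1 y.1 + inner x.2 y.2.
Proof. by []. Qed.

Lemma hsum_nsq (x : hsum H1 H2) : nsq x = nsq x.1 + nsq x.2.
Proof. exact: reD. Qed.

Lemma inner_rep_sum a (x y : hsum H1 H2) :
  inner (rep_sum a x) y = inner (pi1 a x.1) y.1 + inner (pi2 a x.2) y.2.
Proof. by []. Qed.

Lemma rep_sum_representation : star_representation pi1 ->
  star_representation pi2 -> star_representation rep_sum.
Proof.
move=> h1 h2; split.
- move=> a; split=> [k x y|].
    congr pair; exact: rep_linear.
  have [M1 M10 hM1] := rep_bounded h1 a; have [M2 M20 hM2] := rep_bounded h2 a.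
  exists (Num.sqrt (M1 + M2))%:C%C => x.
  apply: norm_le_nsq; first by rewrite addr_ge0 ?ltW.
  rewrite !hsum_nsq /=.
  have := hM1 x.1; have := hM2 x.2; have := nsq_ge0 x.1; have := nsq_ge0 x.2.
  nra.
- move=> a b x; congr pair; exact: rep_addl.
- move=> k a x; congr pair; exact: rep_scalel.
- move=> a b x; congr pair; exact: rep_mul.
- by move=> a x y; congr (_ + _); exact: rep_adj.
Qed.
End DirectSumRep.

(** * Complements as vector functionals *)

Section Complement.
Context {R : realType} {A : starAlgType R}.
Implicit Types (f g h : A -> R[i]) (a b c : A).

Section Scalar.
Variable f : A -> R[i].
Hypothesis hf : scalar f.

Lemma scalar_addE a b : f (a + b) = f a + f b.
Proof. by rewrite -[a in LHS]scale1r hf mul1r. Qed.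

Lemma scalar_zeroE : f 0 = 0.
Proof. by apply: (addrI (f 0)); rewrite -scalar_addE !addr0. Qed.

Lemma scalar_scaleE k a : f (k *: a) = k * f a.
Proof. by rewrite -[k *: a]addr0 hf scalar_zeroE addr0. Qed.

Lemma polarization_eq0 : (forall a, f (star a ** a) = 0) ->
  forall a b, f (star b ** a) = 0.
Proof.
move=> f0.
have sym a b : f (star a ** b) + f (star b ** a) = 0.
  have := f0 (a + b).
  by rewrite starD smulDl !smulDr !scalar_addE !f0 add0r addr0.
(* Replacing [a] by ['i *: a] turns the vanishing sum into a vanishing difference. *)
move=> a b; have := sym b a; have := sym b ('i *: a).
rewrite starZ smulZl smulZr !scalar_scaleE conjCi mulNr -mulrBr => /eqP.
rewrite mulf_eq0 (negbTE (neq0Ci _)) /= subr_eq0 => /eqP -> /eqP.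
by rewrite -mulr2n mulrn_eq0 /= => /eqP.
Qed.
End Scalar.

(* There is no unit, so the values on products do not determine f and g
   formally. In the direct sum of the two representation spaces, [(x1, - x2)]
   is orthogonal to the vectors [(pi1 (a ** c) x1, pi2 (a ** c) x2)], and these
   approximate [(pi1 a x1, pi2 a x2)] because [x1] can be replaced by its
   projection onto the closure of its orbit. *)
Lemma representable_ext f g : representable f -> representable g ->
  (forall a, f (star a ** a) = g (star a ** a)) -> f = g.
Proof.
move=> [fl [H1 [pi1 [x1 [h1 fE]]]]] [gl [H2 [pi2 [x2 [h2 gE]]]]] fg.
have fgM a b : f (star b ** a) = g (star b ** a).
  have dl : scalar (fun a => f a - g a).
    by move=> k u v; rewrite fl gl mulrBr opprD addrACA.
  have := @polarization_eq0 _ dl; move/(_ _ a b) => /= dM.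
  apply/eqP; rewrite -subr_eq0; apply/eqP/dM => c.
  by rewrite fg subrr.
apply/funext => a; rewrite -(starK a); move: (star a) => {}a.
have adj1 b : inner x1 (pi1 b x1) = f (star b).
  by rewrite fE (rep_adj h1) starK.
have adj2 b : inner x2 (pi2 b x2) = g (star b).
  by rewrite gE (rep_adj h2) starK.
have [p hp [_ pE]] := cyclic_projection h1 x1.
suff : inner ((x1, - x2) : hsum H1 H2) (pi1 a x1, pi2 a x2) = 0.
  by rewrite inner_hsum /= innerNl adj1 adj2 => /eqP; rewrite subr_eq0 => /eqP.
apply: inner_approx_eq0 => e e0.
have [M M0 hM] := rep_bounded h1 a.
have M2 : 0 < 2 * M by rewrite mulr_gt0.
have [c pc] := hp _ (divr_gt0 e0 M2).
exists (pi1 (a ** c) x1, pi2 (a ** c) x2).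
  rewrite inner_hsum /= innerNl adj1 adj2.
  by rewrite starM fgM subrr.
rewrite hsum_nsq /= -!rep_subl//.
(* Agreement on squares gives the orbit vectors of one algebra element the same norm in both
   spaces. *)
have -> : nsq (pi2 (a - a ** c) x2) = nsq (pi1 (a - a ** c) x1).
  by rewrite /nsq -!rep_star_mul// -fE -gE fg.
rewrite rep_subl// rep_mul// -pE -repB//.
move: pc; rewrite ltr_pdivlMr//; have := hM (p - pi1 c x1); lra.
Qed.

Lemma le_functional_anti f g : representable f -> representable g ->
  le_functional f g -> le_functional g f -> f = g.
Proof.
move=> hf hg fg gf; apply: representable_ext => // a.
by apply/eqP; rewrite eq_le fg gf.
Qed.

(** Two complements lie below each other, so the choice made in [complement] is harmless. *)
Lemma complementE f g h : is_complement f g h -> complement f g = h.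
Proof.
move=> [hh ih mh]; apply: xget_unique => // k [hk ik mk].
by apply: le_functional_anti => //; [apply: mk|apply: mh].
Qed.

Section VectorComplement.
Context {H : hilbertType R} (pi : A -> H -> H).
Hypothesis hpi : star_representation pi.

(** The first three terms of the inequality are the squared norm of [pi a x + pi b z] minus that of
    [pi b z]. As [pi b z] is a limit of vectors [pi a x], the former can be made arbitrarily small,
    which forces minimality. *)
Lemma vector_complement f g x z :
  (forall a, f (star a ** a) = inner (pi a x) (pi a x)) ->
  (forall a b, g (star b ** a) = inner (pi a x) (pi b z)) ->
  (forall b, cyclic pi x (pi b z)) ->
  is_complement f g (fun a => inner (pi a z) z).
Proof.
move=> fE gE xz.
have sq a b : (nsq (pi a x + pi b z))%:C%C = f (star a ** a) + g (star b ** a)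
    + (g (star b ** a))^* + inner (pi b z) (pi b z).
  rewrite -nsqE innerDl !innerDr fE gE [inner (pi b z) (pi a x)]innerC.
  by rewrite !addrA.
split; first exact: vector_representable.
- by move=> a b; rewrite rep_star_mul// -sq ler0c nsq_ge0.
- move=> h' rh' ih' b; rewrite rep_star_mul//.
  (* The case [a = 0] shows that this value is real, so that the comparison can be made in [R]. *)
  have h'0 : 0 <= h' (star b ** b).
    by have := ih' 0 b; rewrite fE gE rep_0l// !inner0l conjC0 !add0r.
  rewrite nsqE -(RRe_real (ger0_real h'0)) lecR.
  apply/ler_addgt0Pr => e e0; have [a ab] := xz b e e0.
  have : 0 <= (nsq (pi (- a) x + pi b z))%:C%C - inner (pi b z) (pi b z)
      + h' (star b ** b) by rewrite sq addrK; apply: ih'.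
  rewrite nsqE -(RRe_real (ger0_real h'0)) -rmorphB -rmorphD /= ler0c.
  by rewrite -[- a]sub0r rep_subl// rep_0l// sub0r [- pi a x + _]addrC; lra.
Qed.
End VectorComplement.

End Complement.

(** * The Lebesgue decomposition *)

(* Projecting the pair of cyclic vectors onto the closure of its orbit does not
   change the functionals, as it commutes with the representation. *)
Lemma joint_representation {R : realType} {A : starAlgType R}
    (f g : A -> R[i]) : representable f -> representable g ->
  exists (H1 H2 : hilbertType R) (pi1 : A -> H1 -> H1) (pi2 : A -> H2 -> H2)
    (x : hsum H1 H2),
  [/\ star_representation pi1, star_representation pi2,
      forall a, f a = inner (pi1 a x.1) x.1,
      forall a, g a = inner (pi2 a x.2) x.2
    & cyclic (rep_sum pi1 pi2) x x].
Proof.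
move=> [_ [H1 [pi1 [y1 [h1 fE]]]]] [_ [H2 [pi2 [y2 [h2 gE]]]]].
have hpi := rep_sum_representation h1 h2.
have [p hp [_ pE]] := cyclic_projection hpi ((y1, y2) : hsum H1 H2).
have pE1 a : pi1 a p.1 = pi1 a y1 by have /(congr1 fst) := pE a.
have pE2 a : pi2 a p.2 = pi2 a y2 by have /(congr1 snd) := pE a.
exists H1, H2, pi1, pi2, p; split=> //.
- by move=> a; rewrite fE -pE1 !(rep_adj h1) pE1.
- by move=> a; rewrite gE -pE2 !(rep_adj h2) pE2.
- by move=> e /hp[a pa]; exists a; rewrite pE.
Qed.

(** The filter is arbitrary so as to cover both the sequences and the double sequences of
    [abs_continuous]. *)
Lemma cvg0_realP {R : realType} {T : Type} {F : set_system T} {FF : Filter F}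
    (q : T -> R) :
  ((fun t => (q t)%:C%C : (R[i])^o) @ F --> (0 : (R[i])^o)) <->
  forall e : R, 0 < e -> \forall t \near F, `|q t| < e.
Proof.
have normE (r : R) : `|r%:C%C| = `|r|%:C%C.
  by rewrite normc_def /= expr0n addr0 sqrtr_sqr.
split=> [/cvgr0Pnorm_lt h e e0|h];
  last apply/cvgr0Pnorm_lt => _ /gt0_complexP[e e0 ->].
- have e0' : 0 < e%:C%C by rewrite ltcR.
  by apply: filterS (h _ e0') => t; rewrite normE ltcR.
- by apply: filterS (h _ e0) => t; rewrite normE ltcR.
Qed.

Section LebesgueDecomposition.
Context {R : realType} {A : starAlgType R} {H1 H2 : hilbertType R}.
Variables (pi1 : A -> H1 -> H1) (pi2 : A -> H2 -> H2).
Hypotheses (h1 : star_representation pi1) (h2 : star_representation pi2).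
Variable x : hsum H1 H2.
Local Notation pi := (rep_sum pi1 pi2).
Hypothesis xx : cyclic pi x x.
Variables (f g : A -> R[i]).
Hypothesis fE : forall a, f a = inner (pi1 a x.1) x.1.
Hypothesis gE : forall a, g a = inner (pi2 a x.2) x.2.
Local Notation K := (cyclic pi x).

Let hpi : star_representation pi.
Proof. exact: rep_sum_representation. Qed.

Let hK : closed_subspace K.
Proof. exact: cyclic_closed_subspace. Qed.

Let Kpi a y : K y -> K (pi a y).
Proof. exact: cyclic_rep. Qed.

(* z and t are the projections of (x.1, 0) and (0, x.2) onto K. *)
Variable z : hsum H1 H2.
Hypotheses (Kz : K z) (zP : forall y, K y -> inner z y = inner x.1 y.1).
Let t := x - z.

Let Kt : K t.
Proof. exact: (@closed_subspaceB _ _ K). Qed.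

Let tP y : K y -> inner t y = inner x.2 y.2.
Proof. by move=> Ky; rewrite innerBl inner_hsum zP// addrAC subrr add0r. Qed.

Let zrepP a y : K y -> inner (pi a z) y = inner (pi1 a x.1) y.1.
Proof. by move=> Ky; rewrite (rep_adj hpi) zP ?(rep_adj h1)//; exact: Kpi. Qed.

Let trepP a y : K y -> inner (pi a t) y = inner (pi2 a x.2) y.2.
Proof. by move=> Ky; rewrite (rep_adj hpi) tP ?(rep_adj h2)//; exact: Kpi. Qed.

Let fEl a : f a = inner (pi a z) x.
Proof. by rewrite fE zrepP. Qed.

Let gEl a : g a = inner (pi a t) x.
Proof. by rewrite gE trepP. Qed.

Let fEr a : f a = inner (pi a x) z.
Proof. by rewrite innerC zP ?fE -?innerC//; exact: cyclic_orbit. Qed.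

Let gEr a : g a = inner (pi a x) t.
Proof. by rewrite innerC tP ?gE -?innerC//; exact: cyclic_orbit. Qed.

Lemma complement_sumf : is_complement (f + g) f (fun a => inner (pi a z) z).
Proof.
apply: (@vector_complement _ _ _ pi hpi _ _ x) => [a|a b|b].
- by rewrite -rep_star_mul// -[(f + g) _]/(f _ + g _) fEr gEr -innerDr subrKC.
- by rewrite fEr rep_star_mul.
- exact: Kpi.
Qed.

Lemma complement_sumg : is_complement (g + f) g (fun a => inner (pi a t) t).
Proof.
apply: (@vector_complement _ _ _ pi hpi _ _ x) => [a|a b|b].
- by rewrite -rep_star_mul// -[(g + f) _]/(g _ + f _) fEr gEr -innerDr subrK.
- by rewrite gEr rep_star_mul.
- exact: Kpi.
Qed.

Lemma parallel_sumE a : parallel_sum f g a = inner (pi a t) z.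
Proof.
rewrite /parallel_sum (complementE complement_sumf).
by rewrite -[(_ - _) a]/(f a - inner (pi a z) z) fEr -innerBl -repB.
Qed.

(** Exchanging [f] and [g] exchanges [z] and [t], and both differences reduce to the product of
    [pi a t] with [z]. This reconciles the two orders in which the theorem writes the parallel
    sum. *)
Lemma parallel_sumC : parallel_sum g f = parallel_sum f g.
Proof.
apply/funext => a; rewrite parallel_sumE.
rewrite {1}/parallel_sum (complementE complement_sumg).
rewrite -[(_ - _) a]/(g a - inner (pi a t) t) gEl -innerBr.
by rewrite opprB addrC subrK.
Qed.

(** The compressions to [K] of the projections onto the two summands add up to the identity, so they
    commute; the two sides apply them to [x] in either order. *)
Let zt1 y : K y -> inner t.1 y.1 = inner z.2 y.2.
Proof.
move=> Ky; have := zP Ky; rewrite inner_hsum /= innerBl => <-.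
by rewrite addrAC subrr add0r.
Qed.

(* With F and G the compressions to K of the projections of [hsum H1 H2] onto
   its two summands, F + G = 1 and the functional is given by the operator
   F G = F G^2 + G F^2. The vector [(t.1, z.2)], that is, (G x).1 and (F x).2,
   realises this sum without a square root. *)
Lemma parallel_sum_representable : representable (parallel_sum f g).
Proof.
have -> : parallel_sum f g =
    (fun a => inner (pi a ((t.1, z.2) : hsum H1 H2)) ((t.1, z.2) : hsum H1 H2)).
  apply/funext => a; rewrite parallel_sumE.
  have zt1_rep b y : K y -> inner t.1 (pi1 b y.1) = inner z.2 (pi2 b y.2).
    by move=> Ky; exact: (zt1 (Kpi b Ky)).
  transitivity (inner (pi1 a t.1) t.1 + inner (pi2 a z.2) z.2) => //.
  (* The first term is carried into the second space, where [t.2 + z.2 = x.2] merges the two; a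
     second use of [zt1_rep] carries the result back. *)
  rewrite (rep_adj h1) zt1_rep// -(rep_adj h2) -innerDr.
  have -> : t.2 + z.2 = x.2 by rewrite subrK.
  rewrite (rep_adj h2) -zt1_rep// -(rep_adj h1).
  by rewrite innerC [RHS]innerC zP//; exact: Kpi.
exact: vector_representable.
Qed.

Lemma sub_parallel_sumE a : g a - parallel_sum f g a = inner (pi a t) t.
Proof. by rewrite parallel_sumE gEl -innerBr. Qed.

Lemma parallel_sum_le : le_functional (parallel_sum f g) g.
Proof.
by move=> a; rewrite -subr_ge0 sub_parallel_sumE rep_star_mul// dnorm_ge0.
Qed.

Local Notation L := (cyclic pi t).

Let hL : closed_subspace L.
Proof. exact: cyclic_closed_subspace. Qed.

Let Lpi a y : L y -> L (pi a y).
Proof. exact: cyclic_rep. Qed.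

Let LK : L `<=` K.
Proof. by apply: cyclic_min => // a; apply: Kpi. Qed.

Variable w : hsum H1 H2.
Hypotheses (Lw : L w) (wP : forall y, L y -> inner (x - w) y = 0).
Let v := x - w.

Let Kv : K v.
Proof. by apply: (@closed_subspaceB _ _ K) => //; apply: LK. Qed.

Let vpi a y : L y -> inner (pi a v) y = 0.
Proof. exact: (@orth_rep _ _ _ _ hpi L). Qed.

(** Since [pi b v] is orthogonal to [L], replacing [x] by [w] does not change the product of
    [pi a t] with [pi b x], which is the value of [g] at [star b ** a]. *)
Lemma complement_diff :
  is_complement (g - parallel_sum f g) g (fun a => inner (pi a w) w).
Proof.
apply: (@vector_complement _ _ _ pi hpi _ _ t) => [a|a b|b].
- rewrite -[(_ - _) _]/(g _ - parallel_sum f g _) sub_parallel_sumE.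
  exact: rep_star_mul.
- rewrite gEl rep_star_mul//; apply/eqP; rewrite -subr_eq0 -innerBr -repB//.
  by rewrite innerC vpi ?conjC0//; exact: cyclic_orbit.
- exact: Lpi.
Qed.

(** The product of [(0, v.2)] with [pi a x] is that of [v] with [pi a t], which vanishes by the
    choice of [w]. So [(0, v.2)] is orthogonal to [K], in particular to [v]. *)
Let v2 : v.2 = 0.
Proof.
apply/eqP; rewrite -(dnorm_eq0 inner) /=.
have : inner ((0, v.2) : hsum H1 H2) v = 0.
  apply: (cyclic_orth (pi := pi) (x := x)) => // a.
  rewrite inner_hsum inner0l add0r.
  rewrite -[X in inner X _]/v.2 -[X in inner _ X]/(pi2 a x.2).
  by rewrite innerC -trepP// -innerC; apply: wP; apply: cyclic_orbit.
by rewrite inner_hsum inner0l add0r => ->.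
Qed.

Let w2 : w.2 = x.2.
Proof. by apply/esym/eqP; rewrite -subr_eq0; apply/eqP; exact: v2. Qed.

Local Notation fr := (parallel_diff (parallel_sum f g) g).

Lemma regular_partE a : fr a = inner (pi1 a w.1) w.1.
Proof.
rewrite /parallel_diff (complementE complement_diff).
rewrite -[(_ - _) a]/(inner (pi a w) w - g a) gE.
by rewrite inner_hsum /= w2 addrK.
Qed.

Lemma regular_part_representable : representable fr.
Proof.
have -> : fr = (fun a => inner (pi1 a w.1) w.1).
  by apply/funext => a; exact: regular_partE.
exact: vector_representable.
Qed.

(** As [v.2 = 0], orthogonality of [v] to [L] takes place in the first component, and the cross
    terms of [x.1 = w.1 + v.1] vanish. *)
Lemma singular_partE a : f a - fr a = inner (pi a v) v.
Proof.
have wv : inner w.1 (pi1 (star a) v.1) = 0.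
  have := vpi (star a) Lw; rewrite inner_rep_sum v2 rep0// inner0l addr0.
  by move=> h; rewrite innerC h conjC0.
have vw : inner v.1 (pi1 (star a) w.1) = 0.
  have := wP (Lpi (star a) Lw).
  by rewrite -/v inner_hsum v2 inner0l addr0.
have xE : x.1 = w.1 + v.1 by rewrite /v /= addrC subrK.
rewrite fE regular_partE inner_rep_sum v2 inner0r addr0.
move: wv vw xE; move: v.1 => v1 wv vw ->.
rewrite !(rep_adj h1) repD// !innerDr !innerDl wv vw addr0 add0r.
by rewrite addrAC subrr add0r.
Qed.

Lemma singular_part_representable : representable (f - fr).
Proof.
have -> : f - fr = (fun a => inner (pi a v) v).
  by apply/funext => a; exact: singular_partE.
exact: vector_representable.
Qed.

Lemma regular_part_abs_continuous : abs_continuous fr g.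
Proof.
move=> u.
have gq a : g (star a ** a) = (nsq (pi2 a x.2))%:C%C.
  by rewrite gE rep_star_mul// nsqE.
have frq a : fr (star a ** a) = (nsq (pi1 a w.1))%:C%C.
  by rewrite regular_partE rep_star_mul// nsqE.
under eq_fun do rewrite gq.
under [in X in _ -> X -> _]eq_fun do rewrite frq.
under [in X in _ -> _ -> X]eq_fun do rewrite frq.
move=> /cvg0_realP g0 /cvg0_realP fr_cauchy; apply/cvg0_realP.
have [e e0|y1 uy] := @nsq_cauchy_cvg _ _ (fun n => pi1 (u n) w.1).
  have [[P Q] [/= [N1 _ hP] [N2 _ hQ]] hPQ] := fr_cauchy e e0.
  exists (maxn N1 N2) => n m; rewrite !geq_max => /andP[n1 n2] /andP[m1 m2].
  have := hPQ (n, m) (conj (hP _ n1) (hQ _ m2)).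
  by rewrite /= ger0_norm ?nsq_ge0// rep_subl.
pose y : hsum H1 H2 := (y1, 0).
(* The vectors [pi (u n) w] of [L] converge to [y]: their second component is [pi2 (u n) x.2], as
   [w.2 = x.2]. *)
have Ly : L y.
  case: hL => _ _; apply => e e0.
  have e2 : 0 < e / 2 by rewrite divr_gt0.
  have [N1 uN1] := uy _ e2; have [N2 _ uN2] := g0 _ e2.
  exists (pi (u (maxn N1 N2)) w); first exact: Lpi.
  rewrite hsum_nsq /= sub0r nsqN w2.
  have := uN1 _ (leq_maxl N1 N2); have := uN2 _ (leq_maxr N1 N2).
  by rewrite /= ger0_norm ?nsq_ge0//; lra.
have y0 : inner y y = 0.
  apply: (cyclic_orth (pi := pi) (x := t)) => // a.
  rewrite innerC trepP; last exact: LK.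
  by rewrite inner0r conjC0.
have {}y0 : y1 = 0.
  by move/eqP: y0; rewrite (dnorm_eq0 inner) /= => /eqP[].
move=> e e0; have [N uN] := uy _ e0; exists N => // n /uN.
by rewrite y0 sub0r nsqN /= ger0_norm ?nsq_ge0.
Qed.

Lemma singular_part_singular : singular (f - fr) g.
Proof.
move=> h [_ [H3 [rho [y [hrho hE]]]]] hle hg.
have rho_le (a : A) : nsq (rho a y) <= nsq (pi a v).
  have := hle a; rewrite -[(f - fr) _]/(f _ - fr _) singular_partE hE.
  by rewrite !rep_star_mul// !nsqE lecR.
have rho_le2 (a : A) : nsq (rho a y) <= nsq (pi2 a x.2).
  by have := hg a; rewrite gE hE !rep_star_mul// !nsqE lecR.
suff rho0 a : rho a y = 0.
  by apply/funext => a; rewrite hE rho0 inner0l.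
apply: nsq_eq0; apply/eqP; rewrite eq_le nsq_ge0 andbT.
apply/ler_addgt0Pr => e e0; rewrite add0r.
have [b hb] := Kpi a Kv (divr_gt0 e0 (ltr0n R 4)).
have b2 : nsq (pi2 b x.2) <= nsq (pi a v - pi b x).
  rewrite [leRHS]hsum_nsq -[(_ - _).2]/(pi2 a v.2 - pi2 b x.2).
  rewrite v2 rep0// sub0r nsqN.
  by rewrite lerDr nsq_ge0.
have bv : nsq (pi (a - b) v) <= nsq (pi a v - pi b x).
  (* The two terms on the right are orthogonal, because [pi b w] lies in [L]. *)
  have -> : pi a v - pi b x = pi (a - b) v - pi b w.
    by rewrite rep_subl// -addrA -opprD -repD// subrK.
  rewrite nsqB vpi ?mulr0 ?subr0 ?lerDl ?nsq_ge0//; first exact: Lpi.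
(* Of the two parts of [rho a y], the bound by [f - fr] controls the one at [a - b] and the bound by
   [g] the one at [b]. *)
rewrite -(subrK (rho b y) (rho a y)) -rep_subl//.
apply: le_trans (nsqD_le _ _) _.
have := rho_le (a - b); have := rho_le2 b; lra.
Qed.

End LebesgueDecomposition.

Theorem theorem3p10 (R : realType) (A : starAlgType R) (f g : A -> R[i])
    (hf : representable f) (hg : representable g) :
  let fr := parallel_diff (parallel_sum f g) g in
  (* the parallel sums and the parallel difference are well defined *)
  [/\ complement_exists (f + g) f,
      complement_exists (g + f) g
    & parallel_diff_defined (parallel_sum f g) g] /\
  [/\ representable fr,
      abs_continuous fr g,
      lebesgue_decomposition f g fr (f - fr),
      complement_exists (g - parallel_sum g f) g
    & fr = complement (g - parallel_sum g f) g - g].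
Proof.
have [H1 [H2 [pi1 [pi2 [x [h1 h2 fE gE xx]]]]]] := joint_representation hf hg.
have hpi := rep_sum_representation h1 h2.
have [z Kz zP] := orthogonal_projection ((x.1, 0) : hsum H1 H2)
  (cyclic_closed_subspace hpi x).
have {}zP y : cyclic (rep_sum pi1 pi2) x y -> inner z y = inner x.1 y.1.
  move=> /zP /eqP; rewrite innerBl subr_eq0 => /eqP <-.
  by rewrite inner_hsum /= inner0l addr0.
have [w Lw wP] := orthogonal_projection x (cyclic_closed_subspace hpi (x - z)).
have Cf := complement_sumf h1 h2 fE gE Kz zP.
have Cg := complement_sumg h1 h2 xx fE gE Kz zP.
have Cd := complement_diff h1 h2 xx fE gE Kz zP Lw wP.
have rr := regular_part_representable h1 h2 xx fE gE Kz zP Lw wP.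
have ac := regular_part_abs_continuous h1 h2 xx fE gE Kz zP Lw wP.
move=> fr; rewrite (parallel_sumC h1 h2 xx fE gE Kz zP); split; split=> //.
- by eexists; exact: Cf.
- by eexists; exact: Cg.
- split=> //; last by eexists; exact: Cd.
  + exact: (parallel_sum_representable h1 h2 xx fE gE Kz zP).
  + exact: (parallel_sum_le h1 h2 xx fE gE Kz zP).
- split=> //.
  + exact: (singular_part_representable h1 h2 xx fE gE Kz zP Lw wP).
  + by rewrite subrKC.
  + exact: (singular_part_singular h1 h2 xx fE gE Kz zP Lw wP).
- by eexists; exact: Cd.
Qed.
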